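(* Let $m,n\in\mathbb{N}$, $0<\gamma<mn$, $\delta\in\mathbb{R}$, let $\vec p=(p_1,\dots,p_m)$ with $1\le p_i\le\infty$ be a vector of exponents, and let $1/p=\sum_{i=1}^m1/p_i$. Let $\vec v=(v_1,\dots,v_m)$ be an $m$-tuple of weights on $\mathbb{R}^n$. If $\vec v\in\mathcal{H}_m(\vec p,\gamma,\delta)$ and $p/(mp-1)>1$, then $\delta=\gamma-n/p$.
   Context: A weight is a positive (a.e.) locally integrable function on $\mathbb{R}^n$. $\vec v\in\mathcal{H}_m(\vec p,\gamma,\delta)$ means that the pair $(w,\vec v)$ with $w=\prod_{i=1}^m v_i$ (a weight with $w^{-1}$ locally integrable) is in the class $\mathcal{H}_m(\vec p,\gamma,\delta)$, i.e.: for some numbers $\gamma_1,\dots,\gamma_m$ with $0<\gamma_i<n$ and $\sum_{i=1}^m\gamma_i=\gamma$, there is $C>0$ such that for every ball $B\subset\mathbb{R}^n$ with center $x_B$ $$|B|^{(1-\delta)/n}\prod_{i=1}^m\left(\int_{\mathbb{R}^n}\frac{v_i^{-p_i'}(y)}{(|B|^{1/n}+|x_B-y|)^{(n-\gamma_i+1/m)p_i'}}\,dy\right)^{1/p_i'}\le\frac{C}{|B|}\int_B\prod_{i=1}^m v_i^{-1},$$ where for each $i$ with $p_i=1$ the $i$-th factor is understood as $\left\|\frac{v_i^{-1}}{(|B|^{1/n}+|x_B-\cdot|)^{n-\gamma_i+1/m}}\right\|_\infty$. Here $p_i'$ is the conjugate exponent of $p_i$ ($p_i'=1$ if $p_i=\infty$),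 $n/p=0$ if $p=\infty$, and $p/(mp-1)$ is read as $1/m$ if $p=\infty$. *)

(* Defs.v *)
From HB Require Import structures.
From mathcomp Require Import all_boot all_order all_algebra.
From mathcomp Require Import all_classical all_reals all_analysis.

Set Implicit Arguments.
Unset Strict Implicit.
Unset Printing Implicit Defensive.

Import Order.TTheory GRing.Theory Num.Theory.
Import numFieldNormedType.Exports.

Local Open Scope classical_set_scope.
Local Open Scope ring_scope.

(* Borel sigma-algebra of R^n, generated by the coordinates (as the library
   does for [n.-tuple T]). *)
Section borel_rV.
Context {R : realType} (n : nat).

Definition rV_coord (i : 'I_n) (x : 'rV[R]_n) : R := x ord0 i.

Let rV_set0 : g_sigma_preimage rV_coord set0.
Proof. exact: sigma_algebra0. Qed.

Let rV_setC A : g_sigma_preimage rV_coord A -> g_sigma_preimage rV_coord (~` A).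
Proof. exact: sigma_algebraC. Qed.

Let rV_bigcup (F : (set 'rV[R]_n)^nat) :
  (forall i, g_sigma_preimage rV_coord (F i)) ->
  g_sigma_preimage rV_coord (\bigcup_i (F i)).
Proof. exact: sigma_algebra_bigcup. Qed.

HB.instance Definition _ :=
  @isMeasurable.Build (sigma_display (g_sigma_preimage rV_coord))
  'rV[R]_n (g_sigma_preimage rV_coord) rV_set0 rV_setC rV_bigcup.

Lemma measurable_rV_coord i : measurable_fun [set: 'rV[R]_n] (rV_coord i).
Proof.
move=> _ Y mY; rewrite setTI; apply: sub_sigma_algebra => /=.
rewrite -bigcup_seq/=; exists i => /=; first by rewrite mem_index_enum.
by exists Y => //; rewrite setTI.
Qed.

Lemma measurable_fun_rV d (T : measurableType d) (f : T -> 'rV[R]_n) :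
  (forall i, measurable_fun [set: T] (rV_coord i \o f)) ->
  measurable_fun [set: T] f.
Proof.
move=> mf.
suff h : g_sigma_preimage (fun i => rV_coord i \o f) `<=` @measurable d T.
  by move=> _ A mA; apply: h; rewrite g_sigma_preimage_comp; exists A.
apply: smallest_sub; first exact: sigma_algebra_measurable.
move=> A; rewrite -bigcup_seq => -[i _ [B mB <-]].
exact: mf.
Qed.

End borel_rV.

Section lebesgue_rV.
Context {R : realType}.

Definition rV_cons n (xy : 'rV[R]_n * R) : 'rV[R]_n.+1 :=
  \row_i (if unlift ord0 i is Some j then xy.1 ord0 j else xy.2).

Lemma measurable_rV_cons n :
  measurable_fun [set: 'rV[R]_n * measurableTypeR R] (@rV_cons n).
Proof.
apply: measurable_fun_rV => i.
rewrite (_ : _ \o _ = fun xy => if unlift ord0 i is Some j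
   then rV_coord j xy.1 else xy.2); last first.
  by apply/funext => -[x y]; rewrite /rV_coord /= mxE.
case: (unlift ord0 i) => [j|]; last exact: measurable_snd.
apply: (measurableT_comp (measurable_rV_coord j)).
exact: measurable_fst.
Qed.

Definition borel_lebesgueS n (mu : {measure set 'rV[R]_n -> \bar R}) :
    set 'rV[R]_n.+1 -> \bar R :=
  pushforward (mu \x @lebesgue_measure R)%E (@rV_cons n).

Section borel_lebesgueS_measure.
Variables (n : nat) (mu : {measure set 'rV[R]_n -> \bar R}).

Let muS0 : borel_lebesgueS mu set0 = 0%E.
Proof. by rewrite /borel_lebesgueS /pushforward preimage_set0 measure0. Qed.

Let muS_ge0 A : (0 <= borel_lebesgueS mu A)%E.
Proof. rewrite /borel_lebesgueS /pushforward; exact: measure_ge0. Qed.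

Let muS_sigma_additive : semi_sigma_additive (borel_lebesgueS mu).
Proof.
exact: (@measure_semi_sigma_additive _ _ _
  (measure_function_pushforward__canonical__measure_function_Measure
    (mu \x @lebesgue_measure R)%E (@measurable_rV_cons n))).
Qed.

HB.instance Definition _ := isMeasure.Build _ _ _ (borel_lebesgueS mu)
  muS0 muS_ge0 muS_sigma_additive.

End borel_lebesgueS_measure.

(* n-fold product of the Lebesgue measure of R, on the Borel sets of R^n *)
Fixpoint borel_lebesgue n : {measure set 'rV[R]_n -> \bar R} :=
  match n with
  | 0 => \d_ (0 : 'rV[R]_0)
  | k.+1 => borel_lebesgueS (borel_lebesgue k)
  end.

Lemma measurable_box n (A : 'I_n -> set (measurableTypeR R)) :
  (forall i, measurable (A i)) ->
  measurable [set x : 'rV[R]_n | forall i, A i (x ord0 i)].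
Proof.
move=> mA; rewrite (_ : [set _ | _] =
    \bigcap_(i in [set: 'I_n]) (rV_coord i @^-1` A i)).
  apply: fin_bigcap_measurable; first exact: finite_finset.
  by move=> i _; rewrite -[_ @^-1` _]setTI; exact: measurable_rV_coord measurableT _ (mA i).
by apply/seteqP; split => [x h i _|x h i] /=; [exact: h|exact: h].
Qed.

Lemma borel_lebesgue_box n (A : 'I_n -> set (measurableTypeR R)) :
  (forall i, measurable (A i)) ->
  borel_lebesgue n [set x : 'rV[R]_n | forall i, A i (x ord0 i)] =
  (\prod_(i < n) lebesgue_measure (A i))%E.
Proof.
elim: n A => [A _|n IH A mA] /=.
  by rewrite big_ord0 diracE mem_set// => -[].
rewrite /borel_lebesgueS /pushforward.
have -> : @rV_cons n @^-1` [set x : 'rV[R]_n.+1 | forall i, A i (x ord0 i)] =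
    [set x : 'rV[R]_n | forall i, A (lift ord0 i) (x ord0 i)] `*` A ord0.
  apply/seteqP; split => [[x y] /= h|[x y] /= [hx hy] i].
    by split=> [i|]; [have := h (lift ord0 i)|have := h ord0];
      rewrite mxE ?liftK ?unlift_none.
  rewrite mxE; case: unliftP => [j ->|->] //.
rewrite product_measure1E//; last first.
  exact: (@measurable_box _ (fun i => A (lift ord0 i))).
by rewrite (IH (fun i => A (lift ord0 i)))// big_ord_recl muleC.
Qed.

(* [leb_rV n] is R^n with the sigma-algebra of Lebesgue measurable sets, and
   [lebesgue n] is the (complete) n-dimensional Lebesgue measure on it. *)
Definition leb_rV n : Type := caratheodory_type (borel_lebesgue n)^*%mu.

HB.instance Definition _ n := Measurable.copy (leb_rV n)
  (caratheodory_type (borel_lebesgue n)^*%mu).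

Definition lebesgue n : set (leb_rV n) -> \bar R :=
  @completed_measure_extension _ _ _ (borel_lebesgue n).

HB.instance Definition _ n := Measure.on (@lebesgue n).

Lemma lebesgue_box n (A : 'I_n -> set (measurableTypeR R)) :
  (forall i, measurable (A i)) ->
  @lebesgue n [set x : 'rV[R]_n | forall i, A i (x ord0 i)] =
  (\prod_(i < n) lebesgue_measure (A i))%E.
Proof.
move=> mA; rewrite -borel_lebesgue_box//.
apply: measurable_mu_extE; exact: measurable_box.
Qed.

End lebesgue_rV.
Arguments lebesgue {R} n.

Section weights.
Context {R : realType} (n : nat).
Implicit Types (x y : 'rV[R]_n) (r : R) (f w : 'rV[R]_n -> R).
Local Notation mu := (lebesgue n : {measure set (leb_rV n) -> \bar R}).

(* the library's norm on ['rV_n] is the sup norm *)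
Definition enorm x : R := Num.sqrt (\sum_(i < n) x ord0 i ^+ 2).

Definition eball x r : set 'rV[R]_n := [set y | enorm (x - y) < r].

Definition vol x r : R := fine (mu (eball x r)).

Definition locally_integrable_rV f :=
  measurable_fun [set: leb_rV n] f /\
  forall K : set 'rV[R]_n, compact K -> (\int[mu]_(y in K) `|f y|%:E < +oo)%E.

Definition weight w :=
  locally_integrable_rV w /\ {ae mu, forall y, 0 < w y}.

End weights.

Section class_H.
Context {R : realType} (m n : nat).
Implicit Types (p : 'I_m -> \bar R) (v : 'I_m -> 'rV[R]_n -> R).
Implicit Types (gamma delta : R).
Local Notation mu := (lebesgue n : {measure set (leb_rV n) -> \bar R}).

(* The i-th factor of the product on the ball with center x and radius r; here
   s, a and u stand for p_i, gamma_i and v_i. *)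
Definition H_factor (s : \bar R) (a : R) (u : 'rV[R]_n -> R)
    (x : 'rV[R]_n) (r : R) : \bar R :=
  let D (y : 'rV[R]_n) := vol x r `^ n%:R^-1 + enorm (x - y) in
  let e := n%:R - a + m%:R^-1 in
  let q := fine (hoelder_conjugate s) in
  if s == 1%E then ('N[mu]_+oo[(fun y => ((u y)^-1 / D y `^ e)%:E)])%E
  else ((\int[mu]_y (u y `^ (- q) / D y `^ (e * q))%:E) `^ q^-1)%E.

Definition class_H p gamma delta v : Prop :=
  [/\ weight (fun y => \prod_(i < m) v i y),
      locally_integrable_rV (fun y => (\prod_(i < m) v i y)^-1) &
      exists g : 'I_m -> R,
        [/\ forall i, 0 < g i < n%:R,
            \sum_(i < m) g i = gamma &
            exists2 C : R, 0 < C &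
            forall (x : 'rV[R]_n) (r : R), 0 < r ->
              ((vol x r `^ ((1 - delta) / n%:R))%:E
                 * \prod_(i < m) H_factor (p i) (g i) (v i) x r
               <= (C / vol x r)%:E
                 * \int[mu]_(y in eball x r) (\prod_(i < m) (v i y)^-1)%R%:E)%E]].

(* p / (m p - 1); in [\bar R] division by 0 gives +oo, the value at p = 1/m. *)
Definition exponent_ratio (p : \bar R) : \bar R :=
  if p == +oo%E then (m%:R^-1)%:E else (p / (m%:R%:E * p - 1))%E.

End class_H.

(* Main.v *)
Require Import Defs.
From HB Require Import structures.
From mathcomp Require Import all_boot all_order all_algebra.
From mathcomp Require Import all_classical all_reals all_analysis.
From mathcomp Require Import measurable_realfun ess_sup_inf ring lra.

Set Implicit Arguments.
Unset Strict Implicit.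
Unset Printing Implicit Defensive.

Import Order.TTheory GRing.Theory Num.Theory.
Import numFieldNormedType.Exports.

Local Open Scope classical_set_scope.
Local Open Scope ring_scope.

(** The left side of the class condition bounds the average of $w^{-1}$ from
below, while Hoelder's inequality bounds the same average from above by the
same product of norms; what is left when the product cancels is a bound on a
power of $|B|$ that holds for all balls, so that the power is $0$.

In detail, let $e_i = n - \gamma_i + 1/m$, so that
$\sum_i e_i = mn - \gamma + 1$, let $D(y) = |B|^{1/n} + |x_B - y|$, and let
$F_i$ be the $i$-th factor of the condition. It is the $L^{p_i'}$ norm over
$\mathbb{R}^n$ of $f_i = v_i^{-1} D^{-e_i}$ ([H_factorE]). Let
$\Lambda = \sum_i 1/p_i' = m - 1/p$; the assumption $p/(mp-1) > 1$ gives
$\Lambda \le 1$ ([sum_conjugate_le1]).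

On a ball $B$ one has $D \le K |B|^{1/n}$ with $K = 1 + n$, hence
$v_i^{-1} \le f_i (K |B|^{1/n})^{e_i}$ there ([inv_le_weighted_kernel]).
Hoelder's inequality with the exponents $p_i'$, completed by the exponent
$1/(1-\Lambda)$ for the constant $1$ ([hoelder_prod_bounded]), gives
$$\int_B \prod_i v_i^{-1} \le
  (K |B|^{1/n})^{\sum_i e_i} |B|^{1-\Lambda} \prod_i F_i .$$
The condition says that
$|B|^{(1-\delta)/n} \prod_i F_i \le C |B|^{-1} \int_B \prod_i v_i^{-1}$.
The product of the $F_i$ is positive because the weights are, and finite
because $w^{-1}$ is locally integrable. It cancels, and with
$\sum_i e_i = mn - \gamma + 1$ this leaves ([ball_estimate])
$$|B|^{(\gamma-\delta)/n - 1/p} \le C K^{\sum_i e_i} .$$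
Balls centred at the origin have arbitrarily large and arbitrarily small
volumes, so the exponent vanishes ([powR_vol_bounded_eq0]), which is the
claim. *)

(** * Hoelder's inequality for finitely many functions on a set of finite measure *)

Lemma powR_sum (R : realType) (I : finType) (a : R) (t : I -> R) :
  a != 0 -> a `^ (\sum_i t i) = \prod_i a `^ t i.
Proof.
move=> a0; rewrite /powR (negbTE a0) mulr_suml expR_sum.
by apply: eq_bigr.
Qed.

(** The weighted inequality of arithmetic and geometric means, where the weight
missing to $1$ is carried by the constant $1$. With $T = \sum_i \lambda_i \ln h_i$
it is the weighted sum of the inequalities $e^T (1 + (t - T)) \le e^t$, the
tangent line of $\exp$ at $T$, taken at $t = \ln h_i$ and at $t = 0$. *)
Lemma prod_powR_le_sum (R : realType) (I : finType) (lam h : I -> R) :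
  (forall i, 0 <= lam i) -> \sum_i lam i <= 1 -> (forall i, 0 <= h i) ->
  \prod_i h i `^ lam i <= \sum_i lam i * h i + (1 - \sum_i lam i).
Proof.
move=> lam0 lam1 h0.
have rhs0 : 0 <= \sum_i lam i * h i + (1 - \sum_i lam i).
  by rewrite addr_ge0 ?subr_ge0// sumr_ge0// => i _; rewrite mulr_ge0.
have [/existsP[i /eqP hi0]|/existsPn hN0] :=
    boolP [exists i, h i `^ lam i == 0].
  by rewrite (bigD1 i)//= hi0 mul0r.
(* When some h i is 0 its weight is 0, and [ln 0 = 0] keeps both identities
   below true. *)
have hexp i : h i `^ lam i = expR (lam i * ln (h i)).
  rewrite /powR; case: eqVneq => // hi0.
  have := hN0 i; rewrite /powR hi0 eqxx.
  by have [-> _|_ /eqP//] := eqVneq (lam i) 0; rewrite mul0r expR0.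
have lamexp i : lam i * h i = lam i * expR (ln (h i)).
  have [->|li0] := eqVneq (lam i) 0; first by rewrite !mul0r.
  have hi_gt0 : 0 < h i.
    rewrite lt_neqAle h0 andbT eq_sym; apply/eqP => hi0.
    by have := hN0 i; rewrite hi0 powR0// eqxx.
  by rewrite lnK// posrE.
under eq_bigr do rewrite hexp.
under [in leRHS]eq_bigr do rewrite lamexp.
rewrite -expR_sum; set T := \sum_i lam i * _.
have tangent t : expR T * (1 + (t - T)) <= expR t.
  rewrite (_ : expR t = expR T * expR (t - T)); last first.
    by rewrite -expRD addrC subrK.
  rewrite ler_pM2l ?expR_gt0//.
  exact: expR_ge1Dx.
have := tangent 0; rewrite expR0 sub0r => tangent0.
have -> : expR T = \sum_i lam i * (expR T * (1 + (ln (h i) - T))) +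
    (1 - \sum_i lam i) * (expR T * (1 - T)).
  rewrite (eq_bigr (fun i => expR T * (1 - T) * lam i +
    expR T * (lam i * ln (h i)))); last by move=> i _; ring.
  rewrite big_split/= -!mulr_sumr -/T; ring.
apply: lerD.
  by apply: ler_sum => i _; apply: ler_wpM2l.
by rewrite ler_piMr// subr_ge0.
Qed.

Section hoelder_finite_product.
Context d (T : measurableType d) (R : realType).
Context (mu : {measure set T -> \bar R}).

(** Pointwise Young inequality, then integration. The normalised functions
$h_i = V (|f_i|/N_i)^{q_i}$ satisfy $\int_B h_i \le V$, and
$\prod_i |f_i| \le V^{-\Lambda} \prod_i N_i \prod_i h_i^{1/q_i}$, where the
last product is at most $\sum_i h_i/q_i + (1 - \Lambda)$, whose integral over
$B$ is at most $V$. The factor $V$ in $h_i$ makes the missing weight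
$1 - \Lambda$ contribute on the same scale as the $h_i$, which yields the
exact power $V^{1-\Lambda}$ without an optimisation. An exponent
$q_i = \infty$ has $1/q_i = 0$, so that $h_i$ is the constant $V$ and does
not enter the sum. *)
Lemma hoelder_prod_bounded (I : finType) (q : I -> \bar R) (f : I -> T -> R)
    (N : I -> R) (B : set T) (V : R) :
  measurable B -> mu B = V%:E -> 0 < V ->
  (forall i, (1 <= q i)%E) -> \sum_i fine (q i)^-1 <= 1 ->
  (forall i, measurable_fun [set: T] (f i)) ->
  (forall i, 0 < N i) -> (forall i, 'N[mu]_(q i)[EFin \o f i] = (N i)%:E)%E ->
  (\int[mu]_(x in B) (\prod_i `|f i x|)%:E <=
   (V `^ (1 - \sum_i fine (q i)^-1) * \prod_i N i)%:E)%E.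
Proof.
move=> mB muB V0 q1 lam1 mf N0 fN.
pose lam i := fine (q i)^-1.
have lam0 i : 0 <= lam i.
  rewrite /lam; have := q1 i; case: (q i) => [r| |]// r1.
  by rewrite fine_invr invr_ge0 (le_trans ler01).
pose h i x := V * (`|f i x| / N i) `^ (lam i)^-1.
have h0 i x : 0 <= h i x by rewrite mulr_ge0 ?powR_ge0// ltW.
have mh i : measurable_fun [set: T] (h i).
  apply: measurable_funM => //.
  apply: (measurableT_comp (measurable_powR _)).
  by apply: measurable_funM => //; exact: measurableT_comp.
have int_h i : (\int[mu]_(x in B) (lam i * h i x)%:E <= (lam i * V)%:E)%E.
  have [li0|li0] := eqVneq (lam i) 0.
    by under eq_integral do rewrite li0 mul0r; rewrite integral0 li0 mul0r.
  have qE : q i = ((lam i)^-1)%:E.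
    move: li0; rewrite /lam; have := q1 i.
    case: (q i) => [r| |]//= _; last by rewrite eqxx.
    by rewrite fine_invr invrK.
  rewrite (eq_integral (fun x => (lam i * V * (N i `^ (lam i)^-1)^-1)%:E *
      (`|f i x| `^ (lam i)^-1)%:E)%E); last first.
    move=> x _; rewrite -EFinM /h powRM ?invr_ge0//; last exact: ltW.
    by rewrite -powR_inv1 ?ltW// powRAC powR_inv1 ?powR_ge0//; congr EFin; ring.
  rewrite ge0_integralZl_EFin//; last 2 first.
  - apply/measurable_EFinP/measurable_funTS.
    by apply: (measurableT_comp (measurable_powR _)); exact: measurableT_comp.
  - by rewrite mulr_ge0 ?mulr_ge0 ?invr_ge0 ?powR_ge0// ltW.
  have /(congr1 (fun z => z `^ (lam i)^-1)%E) := fN i.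
  rewrite qE poweR_Lnorm ?invr_eq0// poweR_EFin => intf.
  have Np0 : 0 < N i `^ (lam i)^-1 by rewrite powR_gt0.
  apply: (@le_trans _ _ ((lam i * V / N i `^ (lam i)^-1)%:E *
      (N i `^ (lam i)^-1)%:E)%E); last by rewrite -EFinM mulfVK// gt_eqF.
  apply: lee_wpmul2l.
    by rewrite lee_fin mulr_ge0 ?mulr_ge0 ?invr_ge0 ?powR_ge0// ltW.
  rewrite -intf; apply: ge0_subset_integral => //.
  apply/measurable_EFinP.
  by apply: (measurableT_comp (measurable_powR _)); exact: measurableT_comp.
have muT : (0 < mu [set: T])%E.
  apply: (@lt_le_trans _ _ (mu B)); first by rewrite muB lte_fin.
  by apply: le_measure; rewrite ?inE.
have fh i : \forall x \ae mu, `|f i x| <= N i * (h i x / V) `^ lam i.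
  have hV x : h i x / V = (`|f i x| / N i) `^ (lam i)^-1.
    by rewrite /h mulrAC divff ?gt_eqF// mul1r.
  have [li0|li0] := eqVneq (lam i) 0; last first.
    apply: nearW => x; rewrite hV -powRrM mulVf// powRr1 ?divr_ge0// ?(ltW (N0 i))//.
    by rewrite mulrC divfK// gt_eqF.
  have qE : q i = +oo%E.
    move: li0; rewrite /lam; have := q1 i; case: (q i) => [r| |]//= r1.
    rewrite fine_invr => /eqP; rewrite invr_eq0 => /eqP r0.
    by move: r1; rewrite r0 lee_fin ler10.
  have := fN i; rewrite qE unlock muT => /eqP; rewrite eq_le => /andP[+ _].
  move=> /ess_supP; apply: filterS => x /=.
  by rewrite lee_fin li0 powRr0 mulr1.
have fprod : \forall x \ae mu, \prod_i `|f i x| <=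
    V `^ (- \sum_i lam i) * \prod_i N i *
    (\sum_i lam i * h i x + (1 - \sum_i lam i)).
  have : \forall x \ae mu, forall i, `|f i x| <= N i * (h i x / V) `^ lam i.
    exact: filter_forall.
  apply: filterS => x fhx.
  apply: (@le_trans _ _ (\prod_i (N i * (h i x / V) `^ lam i))).
    by apply: ler_prod => i _; rewrite normr_ge0 fhx.
  have -> : \prod_i (N i * (h i x / V) `^ lam i) =
      V `^ (- \sum_i lam i) * \prod_i N i * \prod_i h i x `^ lam i.
    rewrite big_split/= mulrAC [RHS]mulrC; congr *%R.
    rewrite -sumrN powR_sum//; last by rewrite gt_eqF.
    rewrite -big_split/=; apply: eq_bigr => i _.
    rewrite powRM ?invr_ge0// 1?ltW// mulrC; congr *%R.
    by rewrite -powR_inv1 ?ltW// -powRrM mulN1r.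
  apply: ler_wpM2l; last exact: prod_powR_le_sum.
  by rewrite mulr_ge0 ?powR_ge0// prodr_ge0// => i _; exact: ltW.
pose g x := \sum_i lam i * h i x + (1 - \sum_i lam i).
have g0 x : 0 <= g x.
  by rewrite addr_ge0 ?subr_ge0// sumr_ge0// => i _; rewrite mulr_ge0.
have mg : measurable_fun [set: T] g.
  apply: measurable_funD => //; apply: measurable_sum => i.
  exact: measurable_funM.
have int_g : (\int[mu]_(x in B) (g x)%:E <= V%:E)%E.
  rewrite (eq_integral (fun x => (\sum_i (lam i * h i x)%:E +
      (1 - \sum_i lam i)%:E)%E)); last by move=> x _; rewrite sumEFin.
  have mlh i : measurable_fun B (fun x => (lam i * h i x)%:E).
    by apply/measurable_EFinP/measurable_funTS; exact: measurable_funM.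
  have lh0 i x : (0 <= (lam i * h i x)%:E)%E by rewrite lee_fin mulr_ge0.
  rewrite ge0_integralD//; last 3 first.
  - by move=> x _; exact: sume_ge0.
  - exact: emeasurable_sum.
  - by move=> x _; rewrite lee_fin subr_ge0.
  - rewrite ge0_integral_sum// integral_cst// muB -EFinM.
    apply: (@le_trans _ _ (\sum_i (lam i * V)%:E + ((1 - \sum_i lam i) * V)%:E)%E).
      by apply: leeD2r; exact: lee_sum.
    by rewrite sumEFin -EFinD lee_fin -mulr_suml -mulrDl addrC subrK mul1r.
have c0 : 0 <= V `^ (- \sum_i lam i) * \prod_i N i.
  by rewrite mulr_ge0 ?powR_ge0// prodr_ge0// => i _; exact: ltW.
apply: (@le_trans _ _ (\int[mu]_(x in B)
    ((V `^ (- \sum_i lam i) * \prod_i N i)%:E * (g x)%:E))%E).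
  apply: ae_ge0_le_integral => //.
  - by move=> x _; rewrite lee_fin prodr_ge0.
  - apply/measurable_EFinP/measurable_funTS.
    by apply: measurable_prod => i _; exact: measurableT_comp.
  - by move=> x _; rewrite -EFinM lee_fin mulr_ge0.
  - apply/measurable_EFinP/measurable_funTS; exact: measurable_funM.
  - by apply: filterS fprod => x + _; rewrite -EFinM lee_fin.
rewrite ge0_integralZl_EFin//; last 2 first.
- by move=> x _; rewrite lee_fin.
- exact/measurable_EFinP/measurable_funTS.
apply: (@le_trans _ _ ((V `^ (- \sum_i lam i) * \prod_i N i)%:E * V%:E)%E).
  by apply: lee_wpmul2l.
rewrite -EFinM lee_fin addrC powRD ?(gt_eqF V0) ?implybT// powRr1 ?(ltW V0)//.
by rewrite mulrAC.
Qed.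
End hoelder_finite_product.

(** * Volumes of balls centred at the origin *)

Section ball_geometry.
Context {R : realType} (n : nat).
Local Notation mu := (lebesgue n : {measure set (leb_rV n) -> \bar R}).

Lemma measurable_leb_rV (A : set 'rV[R]_n) :
  measurable A -> measurable (A : set (leb_rV n)).
Proof.
by move=> mA; apply: (sub_caratheodory (borel_lebesgue n)); exact: sub_sigma_algebra.
Qed.

Lemma measurable_fun_leb_rV d (T : measurableType d) (f : 'rV[R]_n -> T) :
  measurable_fun [set: 'rV[R]_n] f -> measurable_fun [set: leb_rV n] f.
Proof.
by move=> mf _ Y mY; apply: measurable_leb_rV; exact: mf.
Qed.

Lemma measurable_enorm (x : 'rV[R]_n) :
  measurable_fun [set: leb_rV n] (fun y : 'rV[R]_n => enorm (x - y)).
Proof.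
apply: measurable_fun_leb_rV.
have -> : (fun y : 'rV[R]_n => enorm (x - y)) =
    (fun y => (\sum_i (x ord0 i - rV_coord i y) ^+ 2) `^ 2^-1).
  apply/funext => y; rewrite powR12_sqrt; last by apply: sumr_ge0 => i _; exact: sqr_ge0.
  by rewrite /enorm; congr Num.sqrt; apply: eq_bigr => i _; rewrite !mxE.
apply: (measurableT_comp (measurable_powR _)).
apply: measurable_sum => i; apply: measurable_funX.
by apply: measurable_funB => //; exact: measurable_rV_coord.
Qed.

Lemma measurable_eball (x : 'rV[R]_n) r :
  measurable (eball x r : set (leb_rV n)).
Proof.
have := @measurable_enorm x measurableT `]-oo, r[%classic (measurable_itv _).
by rewrite setTI; congr measurable.
Qed.

Definition cube (r : R) : set 'rV[R]_n :=
  [set y | forall i, `[- r, r]%classic (y ord0 i)].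

Lemma measurable_cube r : measurable (cube r : set (leb_rV n)).
Proof.
apply: measurable_leb_rV.
by apply: (@measurable_box R n (fun=> `[- r, r]%classic)) => i; exact: measurable_itv.
Qed.

Lemma lebesgue_cube r : 0 <= r -> mu (cube r) = ((2 * r) ^+ n)%:E.
Proof.
move=> r0; rewrite /= /cube (@lebesgue_box R n (fun=> `[- r, r]%classic)); last first.
  by move=> i; exact: measurable_itv.
rewrite (eq_bigr (fun=> (2 * r)%:E)) => [|i _].
  by rewrite prodEFin prodr_const card_ord.
rewrite /= lebesgue_measure_itv/= lte_fin.
case: ltP => [_|]; first by rewrite -EFinD; congr EFin; ring.
by move=> rr; congr EFin; lra.
Qed.

Lemma compact_cube r : compact (cube r).
Proof.
exact: (@rV_compact R n (fun=> `[- r, r]%classic)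
  (fun=> @segment_compact R _ _)).
Qed.

Lemma eball_sub_cube r : eball 0 r `<=` cube r.
Proof.
move=> y; rewrite /eball /enorm /= => yr i; rewrite /= in_itv/= -ler_norml.
apply: le_trans (ltW yr); rewrite -sqrtr_sqr; apply: ler_wsqrtr.
rewrite (bigD1 i)//= !mxE add0r sqrrN lerDl.
by apply: sumr_ge0 => j _; exact: sqr_ge0.
Qed.

(** The half side $r/(2n)$ is smaller than the optimal $r/\sqrt{n}$: it leaves
room for the strict inequality in the definition of the open ball and keeps
roots of $n$ out of the constants. *)
Lemma cube_sub_eball r : (0 < n)%N -> 0 < r ->
  cube (r / (2 * n%:R)) `<=` eball 0 r.
Proof.
move=> n0 r0 y yr; rewrite /eball /enorm /=.
have n1 : 1 <= n%:R :> R by rewrite ler1n.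
have n0' : 0 < n%:R :> R by rewrite ltr0n.
rewrite -[ltRHS]ger0_norm ?ltW// -sqrtr_sqr ltr_sqrt ?exprn_gt0//.
apply: (@le_lt_trans _ _ (\sum_(i < n) (r / (2 * n%:R)) ^+ 2)).
  apply: ler_sum => i _; rewrite !mxE add0r sqrrN -[leLHS]real_normK ?num_real//.
  have yb : `|y ord0 i| <= r / (2 * n%:R).
    by have := yr i; rewrite /= in_itv/= -ler_norml.
  by rewrite ler_sqr// nnegrE divr_ge0 ?mulr_ge0// ltW.
rewrite sumr_const card_ord.
have -> : (r / (2 * n%:R)) ^+ 2 *+ n = r ^+ 2 * (4 * n%:R)^-1.
  by rewrite -[LHS]mulr_natr; field; rewrite gt_eqF.
rewrite gtr_pMr ?exprn_gt0// invf_lt1 ?mulr_gt0//; lra.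
Qed.

Context (n_gt0 : (0 < n)%N).

Lemma mu_eball_vol r : mu (eball 0 r) = (vol (0 : 'rV[R]_n) r)%:E.
Proof.
rewrite /vol fineK// ge0_fin_numE//.
have [r0|r0] := leP 0 r; last first.
  rewrite (_ : eball 0 r = set0) ?measure0//.
  apply/seteqP; split => y //; rewrite /eball /= => h.
  by have := lt_trans h r0; rewrite ltNge sqrtr_ge0.
apply: (@le_lt_trans _ _ (mu (cube r))).
  apply: le_measure; rewrite ?inE; [exact: measurable_eball|exact: measurable_cube|].
  exact: eball_sub_cube.
by rewrite lebesgue_cube// ltry.
Qed.

Lemma vol_le r : 0 <= r -> vol (0 : 'rV[R]_n) r <= (2 * r) ^+ n.
Proof.
move=> r0; rewrite -lee_fin -mu_eball_vol -lebesgue_cube//.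
apply: le_measure; rewrite ?inE; [exact: measurable_eball|exact: measurable_cube|].
exact: eball_sub_cube.
Qed.

Lemma vol_ge r : 0 < r -> (r / n%:R) ^+ n <= vol (0 : 'rV[R]_n) r.
Proof.
move=> r0; rewrite -lee_fin -mu_eball_vol.
have -> : r / n%:R = 2 * (r / (2 * n%:R)).
  by field; rewrite pnatr_eq0 -lt0n.
rewrite -lebesgue_cube; last by rewrite divr_ge0 ?mulr_ge0// ltW.
apply: le_measure; rewrite ?inE; [exact: measurable_cube|exact: measurable_eball|].
exact: cube_sub_eball.
Qed.

Lemma vol_gt0 r : 0 < r -> 0 < vol (0 : 'rV[R]_n) r.
Proof.
move=> r0; apply: (lt_le_trans _ (vol_ge r0)).
by rewrite exprn_gt0// divr_gt0// ltr0n.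
Qed.

Lemma radius_le_vol r : 0 < r -> r <= n%:R * vol (0 : 'rV[R]_n) r `^ n%:R^-1.
Proof.
move=> r0; rewrite mulrC -ler_pdivrMr ?ltr0n//.
have rn0 : 0 <= r / n%:R by rewrite divr_ge0// ltW.
have -> : r / n%:R = ((r / n%:R) ^+ n) `^ n%:R^-1.
  by rewrite -powR_mulrn// -powRrM mulfV ?powRr1// pnatr_eq0 -lt0n.
apply: ge0_ler_powR; rewrite ?nnegrE ?invr_ge0 ?exprn_ge0 ?vol_ge//.
exact/ltW/vol_gt0.
Qed.

Lemma vol_unbounded (t : R) : exists2 r, 0 < r & t <= vol (0 : 'rV[R]_n) r.
Proof.
pose s := Num.max 1 t; have s1 : 1 <= s by rewrite le_max lexx.
have s0 : 0 < s by exact: lt_le_trans s1.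
exists (n%:R * s); first by rewrite mulr_gt0 ?ltr0n.
apply: le_trans (vol_ge _); last by rewrite mulr_gt0 ?ltr0n.
rewrite mulrAC divff ?pnatr_eq0 -?lt0n// mul1r.
apply: (@le_trans _ _ s); first by rewrite le_max lexx orbT.
by apply: ler_eXnr.
Qed.

Lemma vol_small (t : R) : 0 < t -> exists2 r, 0 < r & vol (0 : 'rV[R]_n) r <= t.
Proof.
move=> t0; pose s := Num.min 1 t.
have s0 : 0 < s by rewrite lt_min ltr01.
have s1 : s <= 1 by rewrite ge_min lexx.
exists (s / 2); first by rewrite divr_gt0.
apply: (le_trans (vol_le _)); first by rewrite divr_ge0// ltW.
rewrite mulrC divfK ?pnatr_eq0//.
apply: (@le_trans _ _ s); last by rewrite ge_min lexx orbT.
by apply: ler_iXnr => //; rewrite ltW.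
Qed.

(** A positive exponent is excluded by large balls, a negative one by small
balls. *)
Lemma powR_vol_bounded_eq0 (a C : R) :
  (forall r, 0 < r -> vol (0 : 'rV[R]_n) r `^ a <= C) -> a = 0.
Proof.
(* t is the volume at which the power exceeds the bound C. *)
move=> bnd; pose t := (Num.max 1 C + 1) `^ a^-1.
have C0 : 0 < Num.max 1 C + 1.
  by rewrite ltr_wpDl// le_max ler01.
have CC : C < Num.max 1 C + 1.
  by rewrite ltr_pwDr// le_max lexx orbT.
have t0 : 0 < t by rewrite powR_gt0.
have ta : a != 0 -> t `^ a = Num.max 1 C + 1.
  by move=> a0; rewrite /t -powRrM mulVf// powRr1// ltW.
have [a0|a0|//] := ltgtP a 0.
- have [r r0 rt] := vol_small t0.
  have := bnd r r0; rewrite leNgt => /negP[]; apply: lt_le_trans CC _.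
  rewrite -ta ?lt_eqF// -[a]opprK !(powRN _ (- a)) lef_pV2 ?posrE ?powR_gt0 ?vol_gt0//.
  apply: ge0_ler_powR; rewrite ?nnegrE ?oppr_ge0 ?(ltW a0) ?(ltW t0)//.
  exact/ltW/vol_gt0.
- have [r r0 tr] := vol_unbounded t.
  have := bnd r r0; rewrite leNgt => /negP[]; apply: lt_le_trans CC _.
  rewrite -ta ?gt_eqF//.
  apply: ge0_ler_powR; rewrite ?nnegrE ?(ltW a0) ?(ltW t0)//.
  exact/ltW/vol_gt0.
Qed.

End ball_geometry.

(** * The condition on one ball *)

Section measurability_of_norms.
Context d (T : measurableType d) (R : realType).
Implicit Types (f : T -> R) (B : set T).

Lemma measurable_normr_poweR f (q : R) : measurable_fun [set: T] f ->
  measurable_fun [set: T] (fun x => `|(f x)%:E| `^ q)%E.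
Proof.
move=> mf; apply: (measurableT_comp (measurable_poweR _)).
by apply: measurableT_comp => //; exact/measurable_EFinP.
Qed.

Lemma measurable_EFin_sub f B : measurable_fun [set: T] f ->
  measurable_fun B (fun x => (f x)%:E).
Proof. by move=> mf; exact/measurable_EFinP/measurable_funTS. Qed.

Lemma measurable_abse_EFin_sub f B : measurable_fun [set: T] f ->
  measurable_fun B (fun x => `|(f x)%:E|)%E.
Proof. by move=> mf; apply: measurableT_comp => //; exact: measurable_EFin_sub. Qed.

Lemma measurable_prod_normr (I : finType) (f : I -> T -> R) :
  (forall i, measurable_fun [set: T] (f i)) ->
  measurable_fun [set: T] (fun x => \prod_i `|f i x|).
Proof.
by move=> mf; apply: measurable_prod => i _; exact: measurableT_comp.
Qed.

End measurability_of_norms.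

Section ball_estimate.
Context {R : realType} (m n : nat).
Local Notation mu := (lebesgue n : {measure set (leb_rV n) -> \bar R}).

(** The function $u^{-1} D^{-e}$ whose norm is a factor of the condition. The
power $-1$ agrees with the inverse where $u > 0$, that is almost everywhere
for a weight; unlike the inverse it is one of the powers whose measurability
and multiplicativity are used in [H_factorE]. *)
Definition weighted_kernel (e : R) (u : 'rV[R]_n -> R) (x : 'rV[R]_n) (r : R)
    (y : 'rV[R]_n) : R :=
  u y `^ (-1) * (vol x r `^ n%:R^-1 + enorm (x - y)) `^ (- e).

Lemma measurable_kernel_base a (x : 'rV[R]_n) (e : R) :
  measurable_fun [set: leb_rV n] (fun y : 'rV[R]_n => (a + enorm (x - y)) `^ e).
Proof.
apply: (measurableT_comp (measurable_powR e)).
exact: (measurable_funD (measurable_cst _) (measurable_enorm x)).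
Qed.

Lemma measurable_weighted_kernel e (u : 'rV[R]_n -> R) x r :
  measurable_fun [set: leb_rV n] u ->
  measurable_fun [set: leb_rV n] (weighted_kernel e u x r).
Proof.
move=> mfu; apply: measurable_funM.
  exact: (measurableT_comp (measurable_powR _)).
exact: measurable_kernel_base.
Qed.

(** The two branches in the definition of a factor are the finite and the
infinite case of one Lebesgue norm. *)
Lemma H_factorE (s : \bar R) (a : R) (u : 'rV[R]_n -> R) x r :
  (1 <= s)%E -> measurable_fun [set: leb_rV n] u ->
  {ae mu, forall y, 0 < u y} ->
  H_factor m s a u x r =
  ('N[mu]_(hoelder_conjugate s)
     [EFin \o weighted_kernel (n%:R - a + m%:R^-1) u x r])%E.
Proof.
move=> s1 mfu u0; have aeF : Filter (almost_everywhere mu)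
  by exact: ae_filter_ringOfSetsType.
rewrite /H_factor; set e := n%:R - a + m%:R^-1.
have mk := measurable_weighted_kernel e x r mfu.
have D0 y : 0 <= vol x r `^ n%:R^-1 + enorm (x - y).
  by rewrite addr_ge0 ?powR_ge0// sqrtr_ge0.
have [->|sN1] := eqVneq s 1%E.
  rewrite hoelder_conjugate1 unlock; case: ifPn => // _.
  apply: eq_ess_sup; move: u0; apply: (@filterS _ _ aeF) => y uy0 /=.
  by rewrite /weighted_kernel powR_inv1 ?powRN// ltW.
have [q qE q1] : exists2 q, hoelder_conjugate s = q%:E & 1 <= q.
  have := hoelder_conj_ge1 s1; case E : (hoelder_conjugate s) => [q| |]//.
    by rewrite lee_fin => q1; exists q.
  by move/hoelder_conjugate_eqy : E sN1 => ->; rewrite eqxx.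
rewrite qE /= unlock; congr (_ `^ _)%E.
apply: ge0_ae_eq_integral.
- exact: measurableT.
- apply/measurable_EFinP; rewrite (_ : (fun y => _) = (fun y => u y `^ (- q) *
      (vol x r `^ n%:R^-1 + enorm (x - y)) `^ (- (e * q)))).
    apply: measurable_funM.
      exact: (measurableT_comp (measurable_powR _)).
    exact: measurable_kernel_base.
  by apply/funext => y; rewrite (powRN _ (e * q)).
- exact: measurable_normr_poweR mk.
- by move=> y _; rewrite lee_fin divr_ge0 ?powR_ge0.
- by move=> y _; exact: poweR_ge0.
- move: u0; apply: (@filterS _ _ aeF) => y uy0 _ /=; congr EFin.
  rewrite ger0_norm ?mulr_ge0 ?powR_ge0// /weighted_kernel powRM ?powR_ge0//.
  by rewrite -!powRrM mulN1r mulNr (powRN _ (e * q)).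
Qed.

Lemma weighted_kernel_gt0 e (u : 'rV[R]_n -> R) x r y : 0 < vol x r -> 0 < u y ->
  0 < weighted_kernel e u x r y.
Proof.
move=> V0 u0; apply: mulr_gt0; first exact: powR_gt0.
by apply/powR_gt0/ltr_pwDl; [exact: powR_gt0|exact: sqrtr_ge0].
Qed.

(** On a ball of radius $r$ the distance to the centre is at most $r$, and
$r \le n |B|^{1/n}$. *)
Lemma inv_le_weighted_kernel e (u : 'rV[R]_n -> R) r y : (0 < n)%N -> 0 <= e -> 0 < u y ->
  0 < r -> eball 0 r y ->
  (u y)^-1 <= weighted_kernel e u 0 r y *
              ((1 + n%:R) * vol (0 : 'rV[R]_n) r `^ n%:R^-1) `^ e.
Proof.
move=> n0 e0 u0 r0 By; rewrite /weighted_kernel powR_inv1 ?(ltW u0)//.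
rewrite -mulrA ler_peMr ?invr_ge0 ?(ltW u0)//.
have V0 := vol_gt0 n0 r0.
have D0 : 0 < vol (0 : 'rV[R]_n) r `^ n%:R^-1 + enorm (0 - y).
  by apply: ltr_pwDl; [exact: powR_gt0|exact: sqrtr_ge0].
rewrite powRN mulrC ler_pdivlMr ?powR_gt0// mul1r.
apply: ge0_ler_powR; rewrite ?nnegrE ?(ltW D0)//.
  by rewrite mulr_ge0 ?addr_ge0 ?powR_ge0.
rewrite mulrDl mul1r lerD2l.
by apply: le_trans (radius_le_vol n0 r0); exact: ltW.
Qed.

(** Two bounds on the integral of $w^{-1}$ over the ball, the given one from
below and Hoelder's from above, contain the same product of norms. It can be
cancelled once each norm is known to be positive and finite. *)
Lemma ball_estimate (ps : 'I_m -> \bar R) (g : 'I_m -> R)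
    (v : 'I_m -> 'rV[R]_n -> R) (delta C r : R) :
  let e i := n%:R - g i + m%:R^-1 in
  let Lam := \sum_i fine (hoelder_conjugate (ps i))^-1 in
  (0 < n)%N -> 0 < C -> 0 < r ->
  (forall i, 1 <= ps i)%E -> Lam <= 1 -> (forall i, g i < n%:R) ->
  (forall i, weight (v i)) ->
  locally_integrable_rV (fun y => (\prod_(i < m) v i y)^-1) ->
  ((vol (0 : 'rV[R]_n) r `^ ((1 - delta) / n%:R))%:E
     * \prod_(i < m) H_factor m (ps i) (g i) (v i) 0 r
   <= (C / vol (0 : 'rV[R]_n) r)%:E
     * \int[mu]_(y in eball 0 r) (\prod_(i < m) (v i y)^-1)%R%:E)%E ->
  vol (0 : 'rV[R]_n) r `^ ((1 - delta - \sum_i e i) / n%:R + Lam) <=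
  C * (1 + n%:R) `^ (\sum_i e i).
Proof.
move=> e Lam n0 C0 r0 ps1 Lam1 gn hv [mw iw] hB.
have aeF : Filter (almost_everywhere mu)
  by exact: ae_filter_ringOfSetsType.
set B := eball (0 : 'rV[R]_n) r; set V := vol (0 : 'rV[R]_n) r.
have V0 : 0 < V by exact: vol_gt0.
have mB : measurable (B : set (leb_rV n)) by exact: measurable_eball.
have muB : mu B = V%:E by exact: mu_eball_vol.
have e0 i : 0 <= e i by rewrite addr_ge0 ?invr_ge0// subr_ge0 ltW.
pose f i := weighted_kernel (e i) (v i) 0 r.
have mv i : measurable_fun [set: leb_rV n] (v i) := (hv i).1.1.
have mf i : measurable_fun [set: leb_rV n] (f i) by exact: measurable_weighted_kernel.
have v0 : {ae mu, forall y, forall i, 0 < v i y}.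
  by apply: (@filter_forall _ _ _ _ aeF) => i; exact: (hv i).2.
have muT : (0 < mu [set: leb_rV n])%E.
  apply: (@lt_le_trans _ _ (mu B)); first by rewrite muB lte_fin.
  by apply: le_measure; rewrite ?inE.
have HE i : H_factor m (ps i) (g i) (v i) 0 r =
    ('N[mu]_(hoelder_conjugate (ps i))[EFin \o f i])%E.
  by apply: H_factorE => //; exact: (hv i).2.
(* A norm equal to 0 would make the positive function f i vanish a.e. *)
have H0 i : (0 < H_factor m (ps i) (g i) (v i) 0 r)%E.
  rewrite lt_neqAle HE Lnorm_ge0 andbT; apply/eqP => /esym N0.
  have f0 : (EFin \o f i) = cst 0 %[ae mu].
    apply: Lnorm_eq0_eq0 N0; first exact: measurable_EFin_sub (mf i).
    by apply: lt_le_trans (hoelder_conj_ge1 (ps1 i)).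
  have aePF := ae_properfilter_algebraOfSetsType muT.
  have [y [/(_ I) /eqP fy vy]] :=
    @filter_ex _ _ aePF _ (@filterI _ _ aeF _ _ f0 (hv i).2).
  by move: fy; rewrite /= eqe gt_eqF// weighted_kernel_gt0.
pose J := (\int[mu]_(y in B) `|((\prod_(i < m) v i y)^-1)%:E|)%E.
have mwB : measurable_fun (B : set (leb_rV n))
    (fun y => ((\prod_(i < m) v i y)^-1)%:E).
  exact: measurable_EFin_sub.
have IJ : (\int[mu]_(y in B) (\prod_(i < m) (v i y)^-1)%R%:E <= J)%E.
  have -> : (\int[mu]_(y in B) (\prod_(i < m) (v i y)^-1)%R%:E =
      \int[mu]_(y in B) ((\prod_(i < m) v i y)^-1)%:E)%E.
    by apply: eq_integral => y _; rewrite prodfV.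
  by apply: le_trans (le_abse_integral mu mB mwB); exact: lee_abs.
have Jfin : (J < +oo)%E.
  apply: le_lt_trans (iw _ (@compact_cube R n r)).
  apply: ge0_subset_integral; last exact: eball_sub_cube.
  - exact: mB.
  - exact: measurable_cube.
  - exact: measurable_abse_EFin_sub mw.
  - by move=> y _; exact: abse_ge0.
have {}hB : ((V `^ ((1 - delta) / n%:R))%:E
     * \prod_(i < m) H_factor m (ps i) (g i) (v i) 0 r <= (C / V)%:E * J)%E.
  by apply: (le_trans hB); apply: lee_wpmul2l => //; rewrite lee_fin divr_ge0// ltW.
(* One infinite norm would make the left side of the condition infinite, all
   the other norms being positive. *)
have Hfin i : H_factor m (ps i) (g i) (v i) 0 r \is a fin_num.
  rewrite ge0_fin_numE ?(ltW (H0 i))// ltey; apply/eqP => Hy.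
  move: hB; rewrite (bigD1 i)//= Hy gt0_mulye; last first.
    by elim/big_ind: _ => // x y; exact: mule_gt0.
  rewrite gt0_muley ?lte_fin ?powR_gt0// leye_eq => /eqP CJ.
  have : ((C / V)%:E * J < +oo)%E.
    by apply: lte_mul_pinfty => //; rewrite lee_fin divr_ge0// ltW.
  by rewrite CJ.
pose N i := fine (H_factor m (ps i) (g i) (v i) 0 r).
have N0 i : 0 < N i by rewrite fine_gt0// H0 ltey_eq Hfin.
have NE i : H_factor m (ps i) (g i) (v i) 0 r = (N i)%:E by rewrite fineK.
have fN i : ('N[mu]_(hoelder_conjugate (ps i))[EFin \o f i] = (N i)%:E)%E.
  by rewrite -HE NE.
have hoelder := hoelder_prod_bounded mB muB V0
  (fun i => hoelder_conj_ge1 (ps1 i)) Lam1 mf N0 fN.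
pose c := ((1 + n%:R) * V `^ n%:R^-1) `^ (\sum_i e i).
have c0 : 0 <= c by exact: powR_ge0.
have Jle : (J <= c%:E * (V `^ (1 - Lam) * \prod_i N i)%:E)%E.
  have mprodf : measurable_fun (B : set (leb_rV n)) (fun y => (\prod_i `|f i y|)%:E).
    by apply: measurable_EFin_sub; exact: measurable_prod_normr.
  apply: (@le_trans _ _ (\int[mu]_(y in B) (c%:E * (\prod_i `|f i y|)%:E))%E).
    apply: ae_ge0_le_integral.
    + exact: mB.
    + by move=> y _; exact: abse_ge0.
    + exact: measurable_abse_EFin_sub mw.
    + by move=> y _; rewrite mule_ge0// lee_fin// prodr_ge0.
    + exact: measurable_funeM.
    move: v0; apply: (@filterS _ _ aeF) => y vy By; rewrite -EFinM lee_fin.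
    rewrite -prodfV normr_prod /c powR_sum; last first.
      by rewrite mulf_neq0 ?gt_eqF ?powR_gt0 ?ltr_pwDl.
    rewrite -big_split/=; apply: ler_prod => i _; rewrite normr_ge0/=.
    rewrite ger0_norm ?invr_ge0 ?(ltW (vy i))//.
    rewrite [`|f i y|]ger0_norm ?(ltW (weighted_kernel_gt0 _ _ _))// mulrC.
    exact: inv_le_weighted_kernel.
  rewrite ge0_integralZl_EFin; last 4 first.
  - exact: mB.
  - by move=> y _; rewrite lee_fin prodr_ge0.
  - exact: mprodf.
  - exact: c0.
  exact: lee_wpmul2l.
have Np0 : 0 < \prod_i N i by apply: prodr_gt0.
have HN : (\prod_(i < m) H_factor m (ps i) (g i) (v i) 0 r =
    (\prod_i N i)%:E)%E.
  by rewrite -prodEFin; apply: eq_bigr.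
have : (V `^ ((1 - delta) / n%:R) * \prod_i N i <=
    C / V * (c * (V `^ (1 - Lam) * \prod_i N i))).
  rewrite -lee_fin EFinM -HN (EFinM (C / V)) (EFinM c).
  apply: (le_trans hB); apply: lee_wpmul2l => //.
  by rewrite lee_fin divr_ge0// ltW.
rewrite !mulrA ler_pM2r// => main.
have VN0 : V != 0 by rewrite gt_eqF.
have VD a b : V `^ (a + b) = V `^ a * V `^ b by rewrite powRD// VN0 implybT.
have -> : (1 - delta - \sum_i e i) / n%:R + Lam =
    (1 - delta) / n%:R + (Lam - (\sum_i e i) / n%:R) by ring.
rewrite VD; apply: (le_trans (ler_wpM2r (powR_ge0 _ _) main)).
rewrite /c powRM ?powR_ge0// ?addr_ge0// -powRrM VD powRr1 ?(ltW V0)//.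
rewrite powRN VD powRN [_ / n%:R]mulrC.
rewrite le_eqVlt; apply/orP; left; apply/eqP; field.
by rewrite VN0 !powR_eq0 (negbTE VN0).
Qed.

End ball_estimate.

(** * Exponents and conclusion *)

Lemma inve_hoelder_conjugate (R : realType) (s : \bar R) : (1 <= s)%E ->
  exists2 t : R, (s^-1)%E = t%:E & fine (hoelder_conjugate s)^-1 = 1 - t.
Proof.
case: s => [r| |]// => [r1|_]; last first.
  by exists 0; rewrite ?invey// hoelder_conjugatey inve1 /= subr0.
have rN0 : r != 0 by rewrite gt_eqF// (lt_le_trans ltr01).
exists r^-1; first by rewrite inver (negbTE rN0).
rewrite /hoelder_conjugate /= eqe (negbTE rN0) -EFinD.
have [->|r_neq1] := eqVneq r 1.
  by rewrite subrr inve0 mul1e invey invr1 subrr.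
have r1N0 : r - 1 != 0 by rewrite subr_eq0.
rewrite inver (negbTE r1N0) -EFinM fine_invr; field.
by rewrite rN0 r1N0.
Qed.

(** With $t = 1/p$ the ratio $p/(mp-1)$ is $1/(m-t)$ when $m - t > 0$, and
$m - t$ is the sum of the $1/p_i'$. For $t = 0$ the ratio is $1/m \le 1$. *)
Lemma sum_conjugate_le1 (R : realType) (m : nat) (t : R) : (0 < m)%N ->
  0 <= t -> (1 < exponent_ratio m (t%:E)^-1)%E -> m%:R - t <= 1.
Proof.
move=> m0 t0; have [->|tN0] := eqVneq t 0.
  rewrite inve0 /exponent_ratio eqxx lte_fin ltNge invf_le1 ?ltr0n//.
  by rewrite ler1n m0.
have {}t0 : 0 < t by rewrite lt_neqAle eq_sym tN0.
rewrite inver (negbTE tN0) /exponent_ratio /= => ratio1.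
rewrite leNgt; apply/negP => lt1; move: ratio1.
have mt : 0 < m%:R - t by rewrite (lt_trans ltr01).
have mtE : m%:R * t^-1 - 1 = (m%:R - t) / t by field.
rewrite -EFinM -EFinD mtE inver gt_eqF ?divr_gt0// -EFinM lte_fin ltNge => /negP[].
have -> : t^-1 * ((m%:R - t) / t)^-1 = (m%:R - t)^-1.
  by field; rewrite tN0 gt_eqF.
by rewrite invf_le1 // ltW.
Qed.

Theorem theorem1p3 (R : realType) (m n : nat) (hm : (0 < m)%N) (hn : (0 < n)%N)
  (gamma delta : R) (hgamma : 0 < gamma < (m * n)%:R)
  (ps : 'I_m -> \bar R) (hps : forall i, (1 <= ps i)%E)
  (p : \bar R) (hp : (p^-1 = \sum_(i < m) (ps i)^-1)%E)
  (v : 'I_m -> 'rV[R]_n -> R) (hv : forall i, weight (v i))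
  (hH : class_H ps gamma delta v)
  (hratio : (1 < exponent_ratio m p)%E) :
  (delta%:E = gamma%:E - n%:R%:E / p)%E.
Proof.
have [_ iw [g [gn gsum [C C0 hB]]]] := hH.
pose t i := fine (ps i)^-1; pose lam i := fine (hoelder_conjugate (ps i))^-1.
have tE i : ((ps i)^-1)%E = (t i)%:E.
  by have [t' E _] := inve_hoelder_conjugate (hps i); rewrite /t E.
have lamE i : lam i = 1 - t i.
  by have [t' E l] := inve_hoelder_conjugate (hps i); rewrite /lam l /t E.
have t0 i : 0 <= t i by rewrite -lee_fin -tE inve_ge0 (le_trans lee01).
have pV : (p^-1)%E = (\sum_i t i)%:E.
  by rewrite hp -sumEFin; apply: eq_bigr.
have pE : p = ((\sum_i t i)%:E^-1)%E by rewrite -pV inveK.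
have lam_sum : \sum_i lam i = m%:R - \sum_i t i.
  under eq_bigr do rewrite lamE.
  by rewrite sumrB sumr_const card_ord.
have lam1 : \sum_i lam i <= 1.
  rewrite lam_sum; apply: sum_conjugate_le1 => //; first exact: sumr_ge0.
  by rewrite -pE.
have gltn i : g i < n%:R by case/andP: (gn i).
have := powR_vol_bounded_eq0 hn (fun r r0 =>
  ball_estimate hn C0 r0 hps lam1 gltn hv iw (hB 0 r r0)).
have -> : \sum_(i < m) (n%:R - g i + m%:R^-1) = (m * n)%:R - gamma + 1.
  rewrite big_split/= sumrB !sumr_const card_ord gsum natrM mulr_natl.
  by rewrite -[_^-1 *+ m]mulr_natl mulfV// pnatr_eq0 -lt0n.
rewrite -/lam lam_sum natrM => expo0.
rewrite pV -EFinM -EFinB; congr EFin.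
have nN0 : n%:R != 0 :> R by rewrite pnatr_eq0 -lt0n.
have : n%:R * ((1 - delta - (m%:R * n%:R - gamma + 1)) / n%:R +
    (m%:R - \sum_i t i)) = 0 by rewrite expo0 mulr0.
have -> : n%:R * ((1 - delta - (m%:R * n%:R - gamma + 1)) / n%:R +
    (m%:R - \sum_i t i)) = gamma - n%:R * \sum_i t i - delta by field.
by move/eqP; rewrite subr_eq0 => /eqP.
Qed.
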